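(* For any unbiased compressor $\tilde Q$ with parameter $\omega$ and any contraction compressor $Q$ with parameter $\delta$, define $$\tilde Q\circ Q:\ x\mapsto\left(\frac{1}{\omega+1}\,\tilde Q\big(Q(x)_S\big)\right)_{S^{-1}},\qquad x\in\mathbb{R}^d,$$ where $S$ is any subset of $\{1,\dots,d\}$ such that $Q(x)_j=0$ for $j\notin S$ ($S$ can depend on $Q(x)$). Then $\tilde Q\circ Q$ is a contraction compressor with parameter $\frac{\delta}{\omega+1}$.
   Context: $\|\cdot\|$ is the Euclidean norm. A possibly randomized map $Q:\mathbb{R}^d\to\mathbb{R}^d$ is called a contraction compressor (with parameter $\delta$) if there is $0<\delta\le1$ such that $\mathbb{E}[\|x-Q(x)\|^2]\le(1-\delta)\|x\|^2$ for all $x\in\mathbb{R}^d$. A (randomized) map $\tilde Q:\mathbb{R}^d\to\mathbb{R}^d$ is called an unbiased compressor (with parameter $\omega$) if there is $\omega\ge0$ such that $\mathbb{E}[\tilde Q(x)]=x$ and $\mathbb{E}[\|\tilde Q(x)\|^2]\le(\omega+1)\|x\|^2$ for all $x\in\mathbb{R}^d$. In the composition, $\tilde Q$ is applied to the vector $Q(x)_S\in\mathbb{R}^{|S|}$. For $S\subseteq\{1,\dots,d\}$ with elements $S_1<S_2<\dots<S_{|S|}$, where $|S|$ is the cardinality of $S$: for $x\in\mathbb{R}^d$, $x_S\in\mathbb{R}^{|S|}$ is defined by $(x_S)_i=x_{S_i}$ for $1\le i\le|S|$; for $y\in\mathbb{R}^{|S|}$, $y_{S^{-1}}\in\mathbb{R}^d$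 is defined by $(y_{S^{-1}})_{S_i}=y_i$ for $1\le i\le|S|$ and $(y_{S^{-1}})_j=0$ for $j\notin S$. *)

(* Defs.v *)
From HB Require Import structures.
From mathcomp Require Import all_boot all_order all_algebra.
From mathcomp Require Import all_classical all_reals all_analysis.

Set Implicit Arguments.
Unset Strict Implicit.
Unset Printing Implicit Defensive.

Import Order.TTheory GRing.Theory Num.Theory.
Local Open Scope classical_set_scope.
Local Open Scope ring_scope.

(* The library has no measurable structure on matrices.  As for tuples, the
   sigma-algebra is the one generated by the entries; on 'rV[R]_n this is the
   Borel sigma-algebra of R^n. *)
Definition measure_matrix_display : measure_display -> measure_display.
Proof. exact. Qed.

Section measurable_matrix.
Context {disp : measure_display} {T : sigmaRingType disp}.
Variables m n : nat.

Definition matrix_measurable : set (set 'M[T]_(m, n)) :=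
  <<s \bigcup_(ij in [set: 'I_m * 'I_n])
        preimage_set_system [set: 'M[T]_(m, n)]
          (fun A : 'M[T]_(m, n) => A ij.1 ij.2) measurable >>.

Let matrix_set0 : matrix_measurable set0.
Proof. exact: sigma_algebra0. Qed.

Let matrix_setC A : matrix_measurable A -> matrix_measurable (~` A).
Proof. exact: sigma_algebraC. Qed.

Let matrix_bigcup (F : _^nat) : (forall i, matrix_measurable (F i)) ->
  matrix_measurable (\bigcup_i (F i)).
Proof. exact: sigma_algebra_bigcup. Qed.

HB.instance Definition _ :=
  @isMeasurable.Build (measure_matrix_display disp) 'M[T]_(m, n)
    matrix_measurable matrix_set0 matrix_setC matrix_bigcup.

End measurable_matrix.

(* The library's norm `|x| on 'rV[R]_n is the sup norm. *)
Definition l2norm (R : realType) (n : nat) (x : 'rV[R]_n) : R :=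
  Num.sqrt (\sum_(i < n) x 0 i ^+ 2).

(* enum_val lists the elements of S : {set 'I_n} in increasing order, so
   enum_val i is S_{i+1}. *)
Definition restr (R : realType) (n : nat) (S : {set 'I_n}) (x : 'rV[R]_n) :
    'rV[R]_#|S| :=
  \row_(i < #|S|) x 0 (enum_val i).

Definition extend0 (R : realType) (n : nat) (S : {set 'I_n})
    (y : 'rV[R]_#|S|) : 'rV[R]_n :=
  \row_(j < n) if [pick i : 'I_#|S| | enum_val i == j] is Some i
               then y 0 i else 0.

(* A randomized map from R^n to R^n is a family Q : 'rV_n -> T -> 'rV_n of
   random vectors on a probability space (T, P); deterministic maps are the
   case where Q x does not depend on the sample point. *)
Definition contraction_compressor (disp : measure_display)
    (T : measurableType disp) (R : realType) (P : probability T R) (n : nat)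
    (delta : R) (Q : 'rV[R]_n -> T -> 'rV[R]_n) : Prop :=
  [/\ 0 < delta <= 1,
      forall x, measurable_fun [set: T] (Q x) &
      forall x, ('E_P[fun w => (l2norm (x - Q x w) ^+ 2)%R]
                 <= ((1 - delta) * l2norm x ^+ 2)%R%:E)%E].

(* E[Q(x)] = x is read coordinatewise. *)
Definition unbiased_compressor (disp : measure_display)
    (T : measurableType disp) (R : realType) (P : probability T R) (n : nat)
    (omega : R) (Q : 'rV[R]_n -> T -> 'rV[R]_n) : Prop :=
  [/\ 0 <= omega,
      forall x, measurable_fun [set: T] (Q x),
      forall x i, 'E_P[fun w => Q x w 0%R i]%E = (x 0 i)%:E &
      forall x, ('E_P[fun w => (l2norm (Q x w) ^+ 2)%R]
                 <= ((omega + 1) * l2norm x ^+ 2)%R%:E)%E].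

(* The randomness (w.1, w.2) lives on the product of the two sample spaces:
   Qt is drawn independently of Q and S.  Qt k is the compressor on R^k. *)
Definition compose_compressor (T1 T2 : Type) (R : realType) (n : nat)
    (omega : R) (Qt : forall k : nat, 'rV[R]_k -> T2 -> 'rV[R]_k)
    (Q : 'rV[R]_n -> T1 -> 'rV[R]_n) (S : 'rV[R]_n -> T1 -> {set 'I_n})
    (x : 'rV[R]_n) (w : T1 * T2) : 'rV[R]_n :=
  extend0 (S := S x w.1)
    ((omega + 1)^-1 *: Qt #|S x w.1| (restr (S x w.1) (Q x w.1)) w.2).

(* Main.v *)
Require Import Defs.
From mathcomp Require Import all_boot all_order all_algebra.
From mathcomp Require Import all_classical all_reals all_analysis.
From mathcomp Require Import measurable_realfun ring lra.

Import Order.TTheory GRing.Theory Num.Theory.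
Local Open Scope classical_set_scope.
Local Open Scope ring_scope.

Section compression.
Set Implicit Arguments.
Unset Strict Implicit.
Context {R : realType} {n : nat}.
Implicit Types (A : {set 'I_n}) (x q : 'rV[R]_n).

(** Put [c = (omega + 1)^-1] and fix the values [q] of [Q x] and [A] of [S x]. As [q] is supported
    in [A], restricting it to [A] loses nothing. Expanding the square ([sqr_l2norm_sub_extend0]) and
    averaging over [Qt] gives at most |x|^2 - 2c<x,q> + c|q|^2, which is (1-c)|x|^2 + c|x-q|^2: a
    convex combination of the error of sending 0 and the error of sending q
    ([expectation_compress_le]). Averaging over [Q] by Tonelli leaves the factor (1-c) + c(1-delta)
    = 1 - c delta. The remaining work is measurability: the dimension fed to [Qt] is itself random,
    which [measurable_fun_fin_fibers] handles. *)

Lemma sqr_l2norm k (x : 'rV[R]_k) : l2norm x ^+ 2 = \sum_(i < k) x 0 i ^+ 2.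
Proof. by rewrite sqr_sqrtr// sumr_ge0// => i _; rewrite sqr_ge0. Qed.

Lemma extend0_enum_val A (y : 'rV[R]_#|A|) (i : 'I_#|A|) :
  extend0 y 0 (enum_val i) = y 0 i.
Proof.
rewrite mxE; case: pickP => [k /eqP /enum_val_inj ->//|/(_ i)].
by rewrite eqxx.
Qed.

Lemma extend0_notin A (y : 'rV[R]_#|A|) (j : 'I_n) :
  j \notin A -> extend0 y 0 j = 0.
Proof.
move=> jA; rewrite mxE; case: pickP => // k /eqP kj.
by rewrite -kj enum_valP in jA.
Qed.

(** Transfers both norms and inner products between the small space and the full one: coordinates
    outside [A] are zero, and [F] kills them. *)
Lemma sum_extend0 A (y : 'rV[R]_#|A|) (F : 'I_n -> R -> R) :
  (forall j, F j 0 = 0) ->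
  \sum_j F j (extend0 y 0 j) = \sum_(i < #|A|) F (enum_val i) (y 0 i).
Proof.
move=> F0; rewrite (bigID (mem A))/= [X in _ + X]big1 ?addr0; last first.
  by move=> j jA; rewrite extend0_notin.
by rewrite big_enum_val; apply: eq_bigr => i _; rewrite extend0_enum_val.
Qed.

Lemma extend0K A q : (forall j, j \notin A -> q 0 j = 0) ->
  extend0 (restr A q) = q.
Proof.
move=> qA; apply/rowP => j; have [jA|jA] := boolP (j \in A); last first.
  by rewrite extend0_notin// qA.
by rewrite -(enum_rankK_in jA jA) extend0_enum_val mxE.
Qed.

(** The right-hand side separates a constant, a linear and a quadratic term in [z], so that each can
    be integrated by itself. *)
Lemma sqr_l2norm_sub_extend0 A x c (z : 'rV[R]_#|A|) :
  l2norm (x - extend0 (c *: z)) ^+ 2 = l2norm x ^+ 2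
    + (- (2 * c) * (\sum_(i < #|A|) x 0 (enum_val i) * z 0 i)
       + c ^+ 2 * l2norm z ^+ 2).
Proof.
have -> : \sum_(i < #|A|) x 0 (enum_val i) * z 0 i =
    \sum_j x 0 j * extend0 z 0 j.
  by rewrite (sum_extend0 z (F := fun j t => x 0 j * t))// => j; rewrite mulr0.
rewrite !sqr_l2norm.
(* With every sum now over the full index set, the identity can be checked coordinate by
   coordinate. *)
rewrite -(sum_extend0 z (F := fun=> fun t => t ^+ 2)) => [|_]; last first.
  by rewrite expr0n.
rewrite !mulr_sumr -!big_split/=; apply: eq_bigr => j _.
have -> : (x - extend0 (c *: z)) 0 j = x 0 j - c * extend0 z 0 j.
  by rewrite !mxE; case: pickP => [k _|_]; rewrite ?mxE ?mulr0.
ring.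
Qed.

End compression.

Section measurability.
Set Implicit Arguments.
Unset Strict Implicit.
Context {d : measure_display} {T : measurableType d} {R : realType}.

Lemma measurable_mx_entry m n (i : 'I_m) (j : 'I_n) :
  measurable_fun [set: 'M[R]_(m, n)] (fun A : 'M[R]_(m, n) => A i j).
Proof.
move=> _ Y mY; rewrite setTI; apply: sub_sigma_algebra.
by exists (i, j) => //=; exists Y => //; rewrite setTI.
Qed.

Lemma measurable_fun_mx m n (f : T -> 'M[R]_(m, n)) :
  (forall i j, measurable_fun [set: T] (fun t => f t i j)) ->
  measurable_fun [set: T] f.
Proof.
move=> mf.
apply: (measurability (\bigcup_(ij in [set: 'I_m * 'I_n])
  preimage_set_system [set: 'M[R]_(m, n)]
    (fun A : 'M[R]_(m, n) => A ij.1 ij.2) measurable)) => //.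
move=> _ [_ [[i j] _ [Y mY <-]] <-] /=; rewrite setTI.
exact: (mf i j measurableT).
Qed.

Lemma measurable_fun_mx_entry m n (f : T -> 'M[R]_(m, n)) i j :
  measurable_fun [set: T] f -> measurable_fun [set: T] (fun t => f t i j).
Proof. by move=> mf; exact: (measurableT_comp (measurable_mx_entry i j)). Qed.

Lemma measurable_fun_l2norm_sqr n (f : T -> 'rV[R]_n) :
  measurable_fun [set: T] f ->
  measurable_fun [set: T] (fun t => l2norm (f t) ^+ 2).
Proof.
move=> mf; under eq_fun do rewrite sqr_l2norm.
apply: measurable_sum => i; apply: measurable_funX.
exact: measurable_fun_mx_entry.
Qed.

Lemma measurable_fun_subr n x (f : T -> 'rV[R]_n) :
  measurable_fun [set: T] f -> measurable_fun [set: T] (fun t => x - f t).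
Proof.
move=> mf; apply: measurable_fun_mx => i j.
under eq_fun do rewrite !mxE.
by apply: measurable_funB => //; exact: measurable_fun_mx_entry.
Qed.

Lemma measurable_fun_restr n (A : {set 'I_n}) (f : T -> 'rV[R]_n) :
  measurable_fun [set: T] f -> measurable_fun [set: T] (fun t => restr A (f t)).
Proof.
move=> mf; apply: measurable_fun_mx => i j.
by under eq_fun do rewrite !mxE; exact: measurable_fun_mx_entry.
Qed.

Lemma measurable_fun_extend0 n (A : {set 'I_n}) c (f : T -> 'rV[R]_#|A|) :
  measurable_fun [set: T] f ->
  measurable_fun [set: T] (fun t => extend0 (c *: f t)).
Proof.
move=> mf; apply: measurable_fun_mx => i j; under eq_fun do rewrite !mxE.
case: pickP => [k _|_]; last exact: measurable_cst.
under eq_fun do rewrite mxE.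
by apply: measurable_funM => //; exact: measurable_fun_mx_entry.
Qed.

(** Meant for [s] the random support: on a fiber of [s] the dimension is constant, and preimages are
    finite unions over the fibers. *)
Lemma measurable_fun_fin_fibers d' (U : measurableType d') (I : finType)
    (s : T -> I) (f : T -> U) :
  (forall i, measurable [set t | s t = i]) ->
  (forall i, measurable_fun [set t | s t = i] f) -> measurable_fun [set: T] f.
Proof.
move=> ms mf _ Y mY.
rewrite (_ : _ `&` _ =
    \big[setU/set0]_(i : I) ([set t | s t = i] `&` f @^-1` Y)); last first.
  rewrite -bigcup_seq; apply/seteqP; split => t /=.
    by move=> [_ Yt]; exists (s t) => //=; rewrite mem_index_enum.
  by move=> [i _ [_]].
by apply: bigsetU_measurable => i _; exact: mf.
Qed.

End measurability.

(* Here q is a fixed value of Q(x).  Expanding the square, the cross term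
   averages to <x, q> since the compressor is unbiased, and the choice
   c = 1/(omega+1) turns the second moment bound c^2 (omega+1) |q|^2 into
   c |q|^2, completing c |x - q|^2. *)
Lemma expectation_compress_le (d : measure_display) (T : measurableType d)
    (R : realType) (P : probability T R) n (A : {set 'I_n}) omega
    (Qt : 'rV[R]_#|A| -> T -> 'rV[R]_#|A|) (x q : 'rV[R]_n) :
  unbiased_compressor P omega Qt -> (forall j, j \notin A -> q 0 j = 0) ->
  ('E_P[fun w => (l2norm (x - extend0 ((omega + 1)^-1 *: Qt (restr A q) w))
                   ^+ 2)%R]
   <= ((1 - (omega + 1)^-1) * l2norm x ^+ 2
       + (omega + 1)^-1 * l2norm (x - q) ^+ 2)%R%:E)%E.
Proof.
move=> [omega0 mQ meanQ varQ] qA.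
set c := (omega + 1)^-1; set y := restr A q; rewrite unlock.
have o1 : omega + 1 != 0 by rewrite gt_eqF// ltr_wpDl.
have norm_y : l2norm y ^+ 2 = l2norm q ^+ 2.
  rewrite !sqr_l2norm -[in RHS](extend0K qA).
  by rewrite (sum_extend0 _ (F := fun=> fun t => t ^+ 2))// => _; rewrite expr0n.
(* The second moment bound has a finite right-hand side, hence gives integrability. *)
have sqr_int : P.-integrable setT (fun w => (l2norm (Qt y w) ^+ 2)%:E).
  apply/integrableP; split.
    by apply/measurable_EFinP; exact: measurable_fun_l2norm_sqr.
  under eq_integral do rewrite /= ger0_norm ?sqr_ge0//.
  by have := varQ y; rewrite unlock => /le_lt_trans; apply; rewrite ltry.
have cst_int a : P.-integrable setT (fun=> a%:E).
  exact: finite_measure_integrable_cst.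
(* Domination by 1 + |Qt y|^2, from (|t| - 1)^2 >= 0 with t the entry. Integrability is needed
   because the cross term has no sign. *)
have entry_int i : P.-integrable setT (fun w => (Qt y w 0 i)%:E).
  apply: (le_integrable measurableT _ _
    (integrableD measurableT (cst_int 1) sqr_int)).
    by apply/measurable_EFinP; exact: measurable_fun_mx_entry.
  move=> w _ /=; rewrite lee_fin.
  have le_sq : Qt y w 0 i ^+ 2 <= l2norm (Qt y w) ^+ 2.
    rewrite sqr_l2norm (bigD1 i)//= lerDl sumr_ge0// => j _.
    exact: sqr_ge0.
  have := sqr_ge0 (`|Qt y w 0 i| - 1); rewrite sqrrB1 real_normK ?num_real//.
  have := normr_ge0 (Qt y w 0 i).
  have := ler_norm (1 + l2norm (Qt y w) ^+ 2).
  lra.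
pose L w := \sum_(i < #|A|) ((x 0 (enum_val i))%:E * (Qt y w 0 i)%:E)%E.
have L_int : P.-integrable setT L.
  by apply: integrable_sum => // i _; exact: integrableZl.
have LE : (\int[P]_w L w = (\sum_j x 0 j * q 0 j)%:E)%E.
  rewrite integral_sum//; last by move=> i; exact: integrableZl.
  rewrite -[in RHS](extend0K qA).
  rewrite (sum_extend0 _ (F := fun j t => x 0 j * t)); last first.
    by move=> j; rewrite mulr0.
  rewrite -sumEFin; apply: eq_bigr => i _.
  by rewrite integralZl//; have := meanQ y i; rewrite unlock => ->.
rewrite (eq_integral (fun w => (l2norm x ^+ 2)%:E + ((- (2 * c))%:E * L w
    + (c ^+ 2)%:E * (l2norm (Qt y w) ^+ 2)%:E))%E); last first.
  move=> w _; rewrite /L; under eq_bigr do rewrite -EFinM.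
  by rewrite sumEFin -!EFinM -!EFinD -sqr_l2norm_sub_extend0.
rewrite integralD//; last by apply: integrableD => //; exact: integrableZl.
rewrite integral_cst//= probability_setT mule1.
rewrite integralD//; [|exact: integrableZl..].
rewrite !integralZl// LE.
have := varQ y; rewrite unlock norm_y => vy.
(* Here c^2 (omega + 1) = c. *)
have c2 : ((c ^+ 2)%:E * \int[P]_w (l2norm (Qt y w) ^+ 2)%:E <=
    (c * l2norm q ^+ 2)%:E)%E.
  apply: (@le_trans _ _ ((c ^+ 2)%:E * ((omega + 1) * l2norm q ^+ 2)%:E)%E).
    by apply: lee_wpmul2l => //; rewrite lee_fin sqr_ge0.
  by rewrite -EFinM lee_fin expr2 -mulrA mulKf.
apply: (le_trans (leeD2l _ (leeD2l _ c2))).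
rewrite -EFinM -!EFinD !sqr_l2norm.
have -> : \sum_i (x - q) 0 i ^+ 2 =
    \sum_i x 0 i ^+ 2 + (-2) * \sum_i x 0 i * q 0 i + \sum_i q 0 i ^+ 2.
  rewrite mulr_sumr -!big_split/=; apply: eq_bigr => i _; rewrite !mxE; ring.
by rewrite lee_fin le_eqVlt; apply/orP; left; apply/eqP; ring.
Qed.

(* S x w is the random support set chosen for the value Q x w.  Qt only needs to
   be a compressor in the dimensions #|S x w| in which it is applied; joint
   measurability lets it be applied to a random vector. *)
Theorem theorem1p2 (R : realType) (n : nat)
  (disp1 disp2 : measure_display)
  (T1 : measurableType disp1) (T2 : measurableType disp2)
  (P1 : probability T1 R) (P2 : probability T2 R)
  (delta omega : R)
  (Q : 'rV[R]_n -> T1 -> 'rV[R]_n)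
  (Qt : forall k : nat, 'rV[R]_k -> T2 -> 'rV[R]_k)
  (S : 'rV[R]_n -> T1 -> {set 'I_n})
  (hQ : contraction_compressor P1 delta Q)
  (hQt : forall x w, unbiased_compressor P2 omega (Qt #|S x w|))
  (hQt_meas : forall x w, measurable_fun
    [set: 'rV[R]_#|S x w| * T2] (fun p => Qt #|S x w| p.1 p.2))
  (hS_meas : forall x (A : {set 'I_n}), measurable [set w | S x w = A])
  (hS : forall x w j, j \notin S x w -> Q x w 0 j = 0) :
  contraction_compressor (P1 \x P2)%E (delta / (omega + 1))
    (compose_compressor omega Qt Q S).
Proof.
have [/andP[d0 d1] mQ varQ] := hQ.
(* A space of total mass 1 is nonempty; a sample point is needed to extract [0 <= omega] from
   [hQt]. *)
have [t0 _] : [set: T1] !=set0.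
  apply/set0P/eqP => T0; have := probability_setT P1.
  by rewrite T0 measure0 => /eqP; rewrite lt_eqF// lte01.
have [omega0 _ _ _] := hQt 0 t0.
have o1 : 0 < omega + 1 by rewrite ltr_wpDl.
set c := (omega + 1)^-1.
have c01 : 0 < c <= 1 by rewrite invr_gt0 o1 invf_le1// lerDr.
have [c0 c1] := andP c01.
have mC x : measurable_fun [set: T1 * T2] (compose_compressor omega Qt Q S x).
  apply: (measurable_fun_fin_fibers (s := fun w => S x w.1)) => A.
    rewrite (_ : [set _ | _] = [set w | S x w = A] `*` setT).
      exact: measurableX.
    by apply/seteqP; split => w /= => [|[]].
  (* Joint measurability of [Qt] is assumed only in dimensions that are attained; a value [A] never
     taken has an empty fiber. *)
  have [[w0 w0A]|noA] := pselect (exists w0, S x w0 = A); last first.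
    rewrite (_ : [set _ | _] = set0); first exact: measurable_fun_set0.
    by apply/seteqP; split => // w /= wA; apply: noA; exists w.1.
  have mF : measurable_fun [set: T1 * T2] (fun w => extend0
      (c *: Qt #|A| (restr A (Q x w.1)) w.2)).
    apply: measurable_fun_extend0.
    have := hQt_meas x w0; rewrite w0A => mQA.
    have mqA : measurable_fun [set: T1 * T2] (fun w => restr A (Q x w.1)).
      by apply: measurable_fun_restr; exact: measurableT_comp.
    have mp : measurable_fun [set: T1 * T2]
        (fun w => (restr A (Q x w.1), w.2)).
      exact: measurable_fun_pair.
    exact: (measurableT_comp mQA mp).
  (* On the fiber the composition agrees with the map with fixed support [A], which is measurable
     everywhere. *)
  apply: (eq_measurable_fun _ _ (measurable_funTS mF)) => w.
  by rewrite inE/= /compose_compressor => ->.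
split => //.
  by rewrite divr_gt0//= ler_pdivrMr// mul1r (le_trans d1)// lerDr.
move=> x; rewrite unlock.
have mB : measurable_fun [set: T1] (fun w => l2norm (x - Q x w) ^+ 2).
  by apply: measurable_fun_l2norm_sqr; exact: measurable_fun_subr.
have mG : measurable_fun [set: T1 * T2] (fun w => (l2norm (x -
    compose_compressor omega Qt Q S x w) ^+ 2)%:E).
  apply/measurable_EFinP; apply: measurable_fun_l2norm_sqr.
  exact: measurable_fun_subr.
(* Independence enters here: the inner integral, over [T2], is taken with [Q x w] and [S x w]
   frozen. *)
rewrite (fubini_tonelli1 _ mG); last by move=> w; rewrite lee_fin sqr_ge0.
apply: (@le_trans _ _ (\int[P1]_w ((1 - c) * l2norm x ^+ 2
   + c * l2norm (x - Q x w) ^+ 2)%:E)%E).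
  apply: ge0_le_integral => //.
  - by move=> w _; apply: integral_ge0 => v _; rewrite lee_fin sqr_ge0.
  - apply: measurable_fun_fubini_tonelli_F => //.
    by move=> w; rewrite lee_fin sqr_ge0.
  - apply/measurable_EFinP; apply: measurable_funD => //.
    exact: measurable_funM.
  - move=> w _; have := expectation_compress_le x (hQt x w) (hS x w).
    by rewrite unlock.
under eq_integral do rewrite EFinD [X in (_ + X)%E]EFinM.
have Nx0 : 0 <= (1 - c) * l2norm x ^+ 2 by rewrite mulr_ge0 ?sqr_ge0// subr_ge0.
rewrite ge0_integralD//; last 2 first.
- by move=> w _; rewrite -EFinM lee_fin mulr_ge0 ?sqr_ge0// ltW.
- apply/measurable_EFinP; exact: measurable_funM.
rewrite ge0_integralZl_EFin//; last 3 first.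
- by move=> w _; rewrite lee_fin sqr_ge0.
- exact/measurable_EFinP.
- exact: ltW.
rewrite integral_cst//= probability_setT mule1.
have := varQ x; rewrite unlock => vx.
have cB : (c%:E * \int[P1]_w (l2norm (x - Q x w) ^+ 2)%:E <=
    (c * ((1 - delta) * l2norm x ^+ 2))%:E)%E.
  by rewrite EFinM lee_wpmul2l// lee_fin ltW.
apply: (le_trans (leeD2l _ cB)).
(* The two bounds add up: (1 - c) + c (1 - delta) = 1 - delta c. *)
rewrite -EFinD lee_fin [leLHS](_ : _ = (1 - delta * c) * l2norm x ^+ 2)//.
ring.
Qed.
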